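(* In the mixed model with i.i.d. initial opinions in a bounded convex set $\Delta\subset\mathbf{R}^d$ and with social graph $G(t)$ connected for infinitely many $t$, assume that $\inf_{t\ge 0}\mu(t)>0$ and $\epsilon>\mathbf{r}$. Then $$P(\mathscr{C})\ge 1-\frac{\mathbf{E}(\|X-\mathbf{c}\|)}{\epsilon-\mathbf{r}}.$$ In particular, $P(\mathscr{C})=1$ if $\epsilon\ge\operatorname{diam}(\Delta)$.
   Context: Mixed model. $V$ is a finite set of agents, $\|\cdot\|$ is a fixed norm on $\mathbf{R}^d$, $\epsilon>0$ is the confidence threshold, and time is $t=0,1,2,\ldots$. At time $t$ agent $i$ has opinion $x_i(t)\in\mathbf{R}^d$. Given are a sequence of social graphs $G(t)=(V,E(t))$ (simple undirected graphs on $V$, whose edges are the pairs of socially connected agents, possibly varying with $t$) and a sequence of convergence parameters $\mu(t)\in[0,1/2]$; both sequences are deterministic. At each time $t$ with $E(t)\ne\varnothing$, one edge $(i,j)\in E(t)$ is selected uniformly at random, selections at different times being independent of each other and of the initial opinions, and $$x_i(t+1)=x_i(t)+\mu(t)(x_j(t)-x_i(t))\mathbf{1}\{\|x_i(t)-x_j(t)\|\le\epsilon\},$$ $$x_j(t+1)=x_j(t)+\mu(t)(x_i(t)-x_j(t))\mathbf{1}\{\|x_i(t)-x_j(t)\|\le\epsilon\},$$ while all other opinions are unchanged; if $E(t)=\varnothing$, no opinion changes. Standing assumptions: the initial opinions $x_i(0)$, $i\in V$, are independent and identically distributed random variables with values in the bounded convex opinion space $\Delta\subset\mathbf{R}^d$,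 and $X$ is a random variable with the same distribution as each $x_i(0)$; the social graph $G(t)$ is connected for infinitely many $t$. Notation: $\mathbf{c}=\arg\inf_{c\in\mathbf{R}^d}\sup_{z\in\Delta}\|z-c\|$ is the center of $\Delta$ (taken to exist uniquely), $\mathbf{r}=\sup_{z\in\Delta}\|z-\mathbf{c}\|$, $\operatorname{diam}(\Delta)=\sup_{y,z\in\Delta}\|y-z\|$, and $\mathbf{E}$ denotes expectation. The consensus event is $\mathscr{C}=\{\limsup_{t\to\infty}\max_{i,j\in V}\|x_i(t)-x_j(t)\|=0\}$. *)

(* Defs.v *)
From HB Require Import structures.
From mathcomp Require Import all_boot all_order all_algebra.
From mathcomp Require Import finmap.
From mathcomp Require Import all_classical all_reals all_analysis.

Set Implicit Arguments.
Unset Strict Implicit.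
Unset Printing Implicit Defensive.

Import Order.TTheory GRing.Theory Num.Theory.
Import numFieldNormedType.Exports.

Local Open Scope classical_set_scope.
Local Open Scope ring_scope.

(* ['rV[R]_d] carries in the library the max norm and its topology. Its topology
   (hence the Borel sets) is that of every norm on R^d, but the norm [`|_|] itself
   is not used: an arbitrary norm is passed explicitly as a function. *)
Definition is_norm (R : realType) (d : nat) (N : 'rV[R]_d -> R) : Prop :=
  [/\ forall x, N x = 0 -> x = 0,
      forall a x, N (a *: x) = `|a| * N x
    & forall x y, N (x + y) <= N x + N y].

Notation borel_rV R d := (g_sigma_algebraType (@open 'rV[R]_d)).

Section OpinionSpace.
Variables (R : realType) (d : nat) (N : 'rV[R]_d -> R) (Delta : set 'rV[R]_d).

Definition radius_at (c : 'rV[R]_d) : R := sup [set N (z - c) | z in Delta].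

Definition is_center (c : 'rV[R]_d) : Prop :=
  forall c', radius_at c <= radius_at c'.

Definition diam : R := sup [set N (p.1 - p.2) | p in Delta `*` Delta].

End OpinionSpace.

(* A simple undirected graph on V is given by its edge set, a set of
   two-element subsets of V. *)
Section Graph.
Variable V : finType.
Implicit Type E : {set {set V}}.

Definition simple_graph E : Prop := forall e, e \in E -> #|e| = 2%N.

Definition connected_graph E : Prop :=
  forall i j : V, connect (fun a b : V => [set a; b]%SET \in E) i j.

End Graph.

(* Mutual independence of the sigma-algebras F k, for k in D. *)
Definition mutually_independent (disp : measure_display)
    (Omega : measurableType disp) (R : realType) (P : probability Omega R)
    (I : choiceType) (D : set I) (F : I -> set (set Omega)) : Prop :=
  forall (J : {fset I}) (A : I -> set Omega),
    [set` J] `<=` D -> (forall k, k \in J -> F k (A k)) ->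
    P (\bigcap_(k in [set` J]) A k) = (\prod_(k <- J) P (A k))%E.

Section Dynamics.
Variables (R : realType) (d : nat) (V : finType).
Variables (N : 'rV[R]_d -> R) (eps : R).

(* The rule is symmetric in the two endpoints of the selected edge e; it is
   written from the point of view of agent i, whose partner j, if any, is the
   other endpoint of e. *)
Definition interact (m : R) (e : {set V}) (x : V -> 'rV[R]_d) (i : V) :
    'rV[R]_d :=
  if [pick j | (j != i) && (e == [set i; j]%SET)] is Some j
  then (if N (x i - x j) <= eps then x i + m *: (x j - x i) else x i)
  else x i.

Variables (mu : nat -> R) (E : nat -> {set {set V}}).

Section Path.
Variables (sel : nat -> {set V}) (x0 : V -> 'rV[R]_d).

Fixpoint opinions (t : nat) : V -> 'rV[R]_d :=
  if t is s.+1 then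
    if E s == finset.set0 then opinions s
    else interact (mu s) (sel s) (opinions s)
  else x0.

End Path.

Section Random.
Variables (disp : measure_display) (Omega : measurableType disp).
Variables (P : probability Omega R).
Variables (x0 : V -> {RV P >-> borel_rV R d}) (sel : nat -> Omega -> {set V}).

Definition uniform_selection : Prop :=
  forall t, E t != finset.set0 ->
    (forall e, measurable (sel t @^-1` [set e])) /\
    (forall e, e \in E t -> P (sel t @^-1` [set e]) = ((#|E t|%:R)^-1)%:E).

(* The initial opinions and the selections form a single mutually independent
   family; times at which there is no edge to select are left out. *)
Definition independent_sources : Prop :=
  mutually_independent P
    [set k : V + nat | if k is inr t then E t != finset.set0 else true]
    (fun k => match k with
              | inl i => g_sigma_algebra_preimage (x0 i)
              | inr t => preimage_set_system setT (sel t) setT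
              end).

Definition opinion (t : nat) (w : Omega) : V -> 'rV[R]_d :=
  opinions (fun s => sel s w) (fun i => x0 i w) t.

Definition consensus : set Omega :=
  [set w | limn_esup (fun t =>
    (\big[Num.max/0]_(i : V) \big[Num.max/0]_(j : V)
       N (opinion t w i - opinion t w j))%:E) = 0%E].

End Random.
End Dynamics.

(* Main.v *)
Require Import Defs.
From HB Require Import structures.
From mathcomp Require Import all_boot all_order all_algebra.
From mathcomp Require Import finmap ring lra.
From mathcomp Require Import all_classical all_reals all_analysis.
From mathcomp Require Import measurable_realfun.

Set Implicit Arguments.
Unset Strict Implicit.
Unset Printing Implicit Defensive.

Import Order.TTheory GRing.Theory Num.Theory.
Import numFieldNormedType.Exports.

Local Open Scope classical_set_scope.
Local Open Scope ring_scope.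

(** The Euclidean energy [sum_i |x_i|^2] never increases, and drops by a fixed
    amount whenever the selected edge has length in [(delta, eps]]. The state
    at time [t] is independent of the selection at time [t], so the
    probabilities that a given pair is an edge with length in [(delta, eps]]
    are summable over [t]. By Borel-Cantelli, almost surely, for every [delta]
    and all large [t], each edge of the social graph is shorter than [delta] or
    longer than [eps]. Look at such a large [t] with a connected graph. If no
    edge is long, the diameter, which never increases, is at most
    [|V| delta]. If some edge is long, its endpoints are at distance at least
    [eps - r] from [c], and every other agent is linked to such an endpoint by
    short edges, so that [sum_i N (x_i - c) >= |V| (eps - r - |V| delta)]. As
    this sum never increases, without consensus it is initially at least
    [|V| (eps - r)], and Markov's inequality applies. *)

(** * Arbitrary norms, convexity and the Euclidean norm *)

Section Norm.
Variables (R : realType) (d : nat) (N : 'rV[R]_d -> R).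
Hypothesis hN : is_norm N.

Lemma is_norm0 : N 0 = 0.
Proof. by case: hN => _ /(_ 0 0) + _; rewrite scale0r normr0 mul0r. Qed.

Lemma is_normN x : N (- x) = N x.
Proof. by case: hN => _ /(_ (-1) x) + _; rewrite scaleN1r normrN1 mul1r. Qed.

Lemma is_norm_distC x y : N (x - y) = N (y - x).
Proof. by rewrite -is_normN opprB. Qed.

Lemma is_norm_triangle z x y : N (x - y) <= N (x - z) + N (z - y).
Proof. by case: hN => _ _ /(_ (x - z) (z - y)); rewrite addrA subrK. Qed.

(** Nonnegativity is not among the axioms; going from [0] to [0] through [x], the triangle
    inequality gives [0 <= 2 * N x]. *)
Lemma is_norm_ge0 x : 0 <= N x.
Proof.
have := is_norm_triangle x 0 0.
by rewrite subrr is_norm0 sub0r subr0 is_normN -mulr2n pmulrn_lge0.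
Qed.

Lemma is_norm_sum (I : Type) (s : seq I) (F : I -> 'rV[R]_d) :
  N (\sum_(i <- s) F i) <= \sum_(i <- s) N (F i).
Proof.
elim/big_ind2: _ => [|x a y b lx ly|//]; first by rewrite is_norm0.
by case: hN => _ _ hD; apply: le_trans (hD _ _) _; exact: lerD.
Qed.

Lemma is_norm_le_coord x : N x <= \sum_k `|x 0 k| * N (delta_mx 0 k).
Proof.
rewrite [in leLHS](row_sum_delta x) (le_trans (is_norm_sum _ _))//.
by apply: ler_sum => k _; case: hN => _ -> _.
Qed.

End Norm.

(** Convexity is written with the displacement [m *: (y - x)], as in the update rule. *)
Definition convex_on_segments (R : realType) (d : nat) (f : 'rV[R]_d -> R) :=
  forall m x y, 0 <= m <= 1 -> f (x + m *: (y - x)) <= f x + m * (f y - f x).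

Lemma is_norm_dist_convex (R : realType) (d : nat) (N : 'rV[R]_d -> R) z :
  is_norm N -> convex_on_segments (fun x => N (x - z)).
Proof.
move=> hN m x y /andP[m0 m1].
have -> : x + m *: (y - x) - z = (1 - m) *: (x - z) + m *: (y - z).
  by apply/rowP => k; rewrite !mxE; ring.
have [_ hZ hD] := hN.
rewrite (le_trans (hD _ _))// !hZ !ger0_norm ?subr_ge0//.
by rewrite le_eqVlt; apply/orP; left; apply/eqP; ring.
Qed.

Definition sqnorm (R : realType) (d : nat) (x : 'rV[R]_d) : R :=
  \sum_k x 0 k ^+ 2.

Lemma sqnorm_ge0 (R : realType) (d : nat) (x : 'rV[R]_d) : 0 <= sqnorm x.
Proof. by apply: sumr_ge0 => k _; exact: sqr_ge0. Qed.

(** This is what turns an interaction across an edge longer than [delta] in [N] into a definite loss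
    of Euclidean energy. *)
Lemma is_norm_sqr_le (R : realType) (d : nat) (N : 'rV[R]_d -> R) :
  is_norm N -> exists2 K, 0 < K & forall x, N x ^+ 2 <= K * sqnorm x.
Proof.
move=> hN; pose a := \sum_k N (delta_mx 0 k : 'rV[R]_d).
have a0 : 0 <= a by apply: sumr_ge0 => k _; exact: is_norm_ge0.
(* The summand 1 keeps the constant positive even for [d = 0]. *)
exists (1 + a ^+ 2) => [|x]; first by rewrite ltr_pwDl// sqr_ge0.
have s0 := sqnorm_ge0 x.
have xk k : `|x 0 k| <= Num.sqrt (sqnorm x).
  rewrite -sqrtr_sqr ler_sqrt// /sqnorm (bigD1 k)//= lerDl sumr_ge0// => l _.
  exact: sqr_ge0.
have : N x <= Num.sqrt (sqnorm x) * a.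
  rewrite (le_trans (is_norm_le_coord hN x))// mulr_sumr ler_sum// => k _.
  by rewrite ler_wpM2r// is_norm_ge0.
rewrite -ler_sqr ?nnegrE ?is_norm_ge0 ?mulr_ge0 ?sqrtr_ge0// => /le_trans; apply.
by rewrite exprMn sqr_sqrtr// mulrC ler_wpM2r// lerDr.
Qed.

(** * The effect of one interaction *)

Section Interact.
Variables (R : realType) (d : nat) (V : finType).
Variables (N : 'rV[R]_d -> R) (eps : R).
Implicit Types (x : V -> 'rV[R]_d) (i j k : V).
Hypothesis hN : is_norm N.

(** In a two-element edge the partner found by [pick] is forced, so the rule seen from one agent
    becomes a formula for both endpoints. *)
Lemma interact_pairE m i j x k : i != j ->
  interact N eps m [set i; j]%SET x k =
    if N (x i - x j) <= eps then
      if k == i then x i + m *: (x j - x i)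
      else if k == j then x j + m *: (x i - x j) else x k
    else x k.
Proof.
move=> ij; rewrite /interact; case: pickP => [l /andP[lk /eqP/setP e]|none].
  have /orP[/eqP ki|/eqP kj] : (k == i) || (k == j).
  - by have := e k; rewrite !inE eqxx.
  - have -> : l = j.
      by apply/eqP; have := e l; rewrite !inE eqxx orbT -ki (negbTE lk).
    by rewrite ki eqxx.
  - have -> : l = i.
      by apply/eqP; have := e l; rewrite !inE eqxx orbT -kj (negbTE lk) orbF.
    by rewrite kj [j == i]eq_sym (negbTE ij) eqxx (is_norm_distC hN).
have [ki|ki] := eqVneq k i.
  by have := none j; rewrite ki eqxx andbT eq_sym ij.
have [kj|kj] := eqVneq k j; last by case: ifP.
by have := none i; rewrite kj [[set j; i]%SET]finset.setUC eqxx andbT ij.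
Qed.

Lemma interact_cases m e x :
  interact N eps m e x =1 x \/
  exists i j, [/\ i != j, e = [set i; j]%SET & N (x i - x j) <= eps].
Proof.
have [/existsP[i /existsP[j /and3P[ij /eqP ee le]]]|none] :=
  boolP [exists i, exists j,
    [&& i != j, e == [set i; j]%SET & N (x i - x j) <= eps]].
  by right; exists i, j.
left=> k; rewrite /interact; case: pickP => // l /andP[lk ee].
case: ifP => // le; move: none => /negP[]; apply/existsP; exists k.
by apply/existsP; exists l; rewrite ee le eq_sym lk.
Qed.

Lemma interact_sumE m i j x (f : 'rV[R]_d -> R) :
  i != j -> N (x i - x j) <= eps ->
  \sum_k f (interact N eps m [set i; j]%SET x k) =
  \sum_k f (x k) - f (x i) - f (x j)
    + f (x i + m *: (x j - x i)) + f (x j + m *: (x i - x j)).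
Proof.
move=> ij le; have ji : j != i by rewrite eq_sym.
rewrite (bigD1 i)//= (bigD1 j)//= [in RHS](bigD1 i)//= [in RHS](bigD1 j)//=.
rewrite !interact_pairE// le !eqxx (negbTE ji).
rewrite (eq_bigr (fun k => f (x k))); first by ring.
by move=> k /andP[/negbTE ki /negbTE kj]; rewrite interact_pairE// le ki kj.
Qed.

(** The endpoints move towards each other by the same fraction, so the terms [m * (f y - f x)] and
    [m * (f x - f y)] of the two convexity bounds cancel. *)
Lemma interact_sum_le m e x (f : 'rV[R]_d -> R) : 0 <= m <= 1 ->
  convex_on_segments f ->
  \sum_k f (interact N eps m e x k) <= \sum_k f (x k).
Proof.
move=> m01 cf; have [eq|[i [j [ij -> le]]]] := interact_cases m e x.
  by rewrite le_eqVlt; apply/orP; left; apply/eqP/eq_bigr => k _; rewrite eq.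
by rewrite interact_sumE//; have := cf _ (x i) (x j) m01;
  have := cf _ (x j) (x i) m01; lra.
Qed.

Lemma interact_le m e x (f : 'rV[R]_d -> R) B : 0 <= m <= 1 ->
  convex_on_segments f -> (forall k, f (x k) <= B) ->
  forall k, f (interact N eps m e x k) <= B.
Proof.
move=> m01 cf fB k; have [->//|[i [j [ij -> le]]]] := interact_cases m e x.
have seg u v : f u <= B -> f v <= B -> f (u + m *: (v - u)) <= B.
  by move=> uB vB; have := cf _ u v m01; move: m01 => /andP[]; nra.
by rewrite interact_pairE// le; case: ifP => _; [|case: ifP => _];
  rewrite ?seg.
Qed.

(** The interaction keeps the sum of the two opinions and multiplies their difference by
    [1 - 2 * m]. By the parallelogram identity, the loss is half of [1 - (1 - 2 * m) ^+ 2] times the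
    squared distance. *)
Lemma interact_sqnorm m i j x : i != j -> N (x i - x j) <= eps ->
  \sum_k sqnorm (interact N eps m [set i; j]%SET x k) =
  \sum_k sqnorm (x k) - 2 * m * (1 - m) * sqnorm (x i - x j).
Proof.
move=> ij le; rewrite interact_sumE// -!addrA; congr (_ + _).
rewrite /sqnorm -!sumrN -!big_split mulr_sumr -sumrN; apply: eq_bigr => k _.
by rewrite /= !mxE; ring.
Qed.

Lemma interact_sqnorm_le m e x : 0 <= m <= 1 ->
  \sum_k sqnorm (interact N eps m e x k) <= \sum_k sqnorm (x k).
Proof.
move=> /andP[m0 m1]; have [eq|[i [j [ij -> le]]]] := interact_cases m e x.
  by rewrite le_eqVlt; apply/orP; left; apply/eqP/eq_bigr => k _; rewrite eq.
by rewrite interact_sqnorm// gerBl !mulr_ge0 ?subr_ge0 ?sqnorm_ge0.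
Qed.

End Interact.

(** * Monotone quantities along a path *)

Section Opinions.
Variables (R : realType) (d : nat) (V : finType).
Variables (N : 'rV[R]_d -> R) (eps : R) (mu : nat -> R).
Variables (E : nat -> {set {set V}}) (sel : nat -> {set V}) (x0 : V -> 'rV[R]_d).
Hypotheses (hN : is_norm N) (mu01 : forall t, 0 <= mu t <= 2^-1).
Local Notation x := (opinions N eps mu E sel x0).

Let mu_le1 t : 0 <= mu t <= 1.
Proof. by have := mu01 t; lra. Qed.

Lemma opinions_invariant (Q : (V -> 'rV[R]_d) -> Prop) s t : (s <= t)%N ->
  (forall u e y, Q y -> Q (interact N eps (mu u) e y)) -> Q (x s) -> Q (x t).
Proof.
move=> st QS Qs; rewrite -(subnK st); elim: (t - s)%N => [//|n IH].
by rewrite addSn/=; case: ifP => _ //; exact: QS.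
Qed.

Lemma opinions_sum_le (f : 'rV[R]_d -> R) s t : convex_on_segments f ->
  (s <= t)%N -> \sum_k f (x t k) <= \sum_k f (x s k).
Proof.
move=> cf st.
pose Q (y : V -> 'rV[R]_d) : Prop := \sum_k f (y k) <= \sum_k f (x s k).
apply: (@opinions_invariant Q s t st) => [u e y|]; last exact: lexx.
by apply: le_trans; exact: interact_sum_le.
Qed.

Lemma opinions_le (f : 'rV[R]_d -> R) B s t : convex_on_segments f ->
  (s <= t)%N -> (forall k, f (x s k) <= B) -> forall k, f (x t k) <= B.
Proof.
move=> cf st.
apply: (@opinions_invariant (fun y => forall k, f (y k) <= B) s t st) => u e y.
exact: interact_le.
Qed.

(** Distance to a fixed point is convex, so the bound is carried from [s] to [t] in one argument at
    a time, the other being frozen. *)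
Lemma opinions_dist_le B s t : (s <= t)%N ->
  (forall i j, N (x s i - x s j) <= B) -> forall i j, N (x t i - x t j) <= B.
Proof.
move=> st sB i j.
apply: (opinions_le (f := fun u => N (u - x t j)) _ st) => [|{}i].
  exact: is_norm_dist_convex.
rewrite (is_norm_distC hN).
apply: (opinions_le (f := fun u => N (u - x s i)) _ st) => [|{}j].
  exact: is_norm_dist_convex.
exact: sB.
Qed.

Definition energy t := \sum_k sqnorm (x t k).

Lemma energy_ge0 t : 0 <= energy t.
Proof. by apply: sumr_ge0 => k _; exact: sqnorm_ge0. Qed.

Lemma energyS_le t : energy t.+1 <= energy t.
Proof.
by rewrite /energy/=; case: ifP => _ //; exact: interact_sqnorm_le.
Qed.

(* The constant comes from [2 mu (1 - mu) >= mu >= m] for [m <= mu <= 1/2]. *)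
Lemma energyS_drop K m delta t i j : 0 < K ->
  (forall y, N y ^+ 2 <= K * sqnorm y) -> 0 <= m <= mu t ->
  0 <= delta -> i != j -> [set i; j]%SET \in E t -> sel t = [set i; j]%SET ->
  delta < N (x t i - x t j) <= eps ->
  energy t.+1 <= energy t - m * delta ^+ 2 / K.
Proof.
move=> K0 NK /andP[m0 mmu] delta0 ij ijE selt /andP[dN Neps].
have /negbTE E0 : E t != finset.set0 by apply/set0Pn; exists [set i; j]%SET.
rewrite /energy/= E0 selt interact_sqnorm// lerD2l lerN2.
have s0 := sqnorm_ge0 (x t i - x t j).
have ds : delta ^+ 2 / K <= sqnorm (x t i - x t j).
  rewrite ler_pdivrMr// mulrC (le_trans _ (NK _))// ler_sqr ?nnegrE//.
    exact: ltW.
  exact: is_norm_ge0.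
rewrite -mulrA (le_trans (ler_wpM2l m0 ds))// ler_wpM2r//.
by have := mu01 t; nra.
Qed.

(** The initial energy is a budget from which each selection of the pair at distance in
    [(delta, eps]] takes at least [m * delta ^+ 2 / K]. The bound holds on every path. *)
Lemma sum_hits_le K m delta i j T : 0 < K ->
  (forall y, N y ^+ 2 <= K * sqnorm y) -> 0 <= m -> (forall t, m <= mu t) ->
  0 <= delta -> i != j ->
  (\sum_(t < T) ([&& [set i; j]%SET \in E t, sel t == [set i; j]%SET &
     delta < N (x t i - x t j) <= eps] : nat)%:R) * (m * delta ^+ 2 / K)
  <= energy 0.
Proof.
move=> K0 NK m0 mmu delta0 ij.
pose hit t : R := ([&& [set i; j]%SET \in E t, sel t == [set i; j]%SET &
  delta < N (x t i - x t j) <= eps] : nat)%:R.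
suff : energy T <= energy 0 - (\sum_(t < T) hit t) * (m * delta ^+ 2 / K).
  by have := energy_ge0 T; lra.
elim: T => [|T IH]; first by rewrite big_ord0 mul0r subr0.
rewrite big_ord_recr/= mulrDl opprD addrA /(hit T).
case: and3P => [[ijE /eqP selT dN]|_]; last first.
  by rewrite mul0r subr0 (le_trans (energyS_le _)).
have mT : 0 <= m <= mu T by rewrite m0 mmu.
rewrite mul1r (le_trans (energyS_drop K0 NK mT delta0 ij ijE selT dN))//.
by rewrite lerD2r.
Qed.

End Opinions.

(** * Distances across a connected graph *)

Section ConnectedGraph.
Variables (R : realType) (d : nat) (V : finType) (N : 'rV[R]_d -> R).
Variables (G : {set {set V}}) (x : V -> 'rV[R]_d) (delta : R).
Hypotheses (hN : is_norm N) (delta0 : 0 <= delta) (conG : connected_graph G).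
Local Notation edge := (fun a b : V => [set a; b]%SET \in G).

Lemma path_card (i j : V) : exists2 p, path edge i p &
  j = last i p /\ (size p <= #|V|)%N.
Proof.
have /connectP[p pp ->] := conG i j.
have [p' pp' /card_uniqP up' _] := shortenP pp; exists p' => //; split => //.
by rewrite ltnW// -[(size p').+1]/(size (i :: p')) -up' max_card.
Qed.

Lemma connected_dist_le :
  (forall a b, [set a; b]%SET \in G -> N (x a - x b) <= delta) ->
  forall i j, N (x i - x j) <= #|V|%:R * delta.
Proof.
move=> Gd i j; have [p + [->]] := path_card i j.
suff H k : path edge k p -> N (x k - x (last k p)) <= (size p)%:R * delta.
  by move=> /H /le_trans + pV; apply; rewrite ler_wpM2r// ler_nat.
elim: p k => [|l p IH] k /=; first by rewrite subrr is_norm0// mul0r.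
move=> /andP[/Gd kl /IH].
have := is_norm_triangle hN (x l) (x k) (x (last l p)).
by rewrite -natr1 mulrDl mul1r; lra.
Qed.

(* An endpoint of a long edge is far from [c]; the others are linked to such
   an endpoint by a path of short edges. *)
Lemma connected_dist_center_ge eps r c a b :
  (forall i, N (x i - c) <= r) ->
  (forall a b, [set a; b]%SET \in G ->
     N (x a - x b) <= delta \/ eps < N (x a - x b)) ->
  [set a; b]%SET \in G -> eps < N (x a - x b) ->
  forall k, eps - r - #|V|%:R * delta <= N (x k - c).
Proof.
move=> xr Gd abG ab k; have [p + [al sp]] := path_card k a.
have far i j : eps < N (x i - x j) -> eps - r <= N (x i - c).
  have := is_norm_triangle hN c (x i) (x j); have := xr j.
  by rewrite [N (c - _)]is_norm_distC//; lra.
suff H : path edge k p -> eps - r - (size p)%:R * delta <= N (x k - c).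
  move=> /H; apply: le_trans.
  by rewrite lerD2l lerN2 ler_wpM2r// ler_nat.
elim: p k al {sp} => [|l p IH] k /=.
  by move=> <- _; rewrite mul0r subr0 (far _ _ ab).
move=> al /andP[/Gd kl /(IH _ al)].
rewrite -natr1 mulrDl mul1r.
have sd : 0 <= (size p)%:R * delta by rewrite mulr_ge0.
case: kl => [kl|/far]; last first.
  move=> h _; apply: le_trans h; rewrite lerBlDr lerDl addr_ge0//.
have := is_norm_triangle hN (x k) (x l) c; rewrite [N (x l - x k)]is_norm_distC//.
by lra.
Qed.

End ConnectedGraph.

(** * Long-time behaviour of a single path *)

Lemma infinite_set_ge (A : set nat) T : infinite_set A ->
  exists2 t, A t & (T <= t)%N.
Proof.
move=> infA; apply/not_exists2P => noA; apply: infA.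
apply: (sub_finite_set _ (finite_II T)) => t At /=.
by have [//|/negP] := noA t; rewrite -ltnNge.
Qed.

Lemma invr_small (R : realType) (a : R) : 0 < a -> exists n, n.+1%:R^-1 <= a.
Proof.
move=> a0; exists (Num.bound a^-1).
rewrite -[leRHS]invrK lef_pV2 ?posrE ?invr_gt0//.
have := archi_boundP (ltW (_ : 0 < a^-1)); rewrite invr_gt0 => /(_ a0) /ltW.
by move=> /le_trans; apply; rewrite ler_nat.
Qed.

Section LongTime.
Variables (R : realType) (d : nat) (V : finType).
Variables (N : 'rV[R]_d -> R) (eps : R) (mu : nat -> R).
Variables (E : nat -> {set {set V}}) (sel : nat -> {set V}) (x0 : V -> 'rV[R]_d).
Hypotheses (hN : is_norm N) (mu01 : forall t, 0 <= mu t <= 2^-1).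
Local Notation x := (opinions N eps mu E sel x0).

(** The diameter never increases, so being below [eta] at one time is being below [eta] from then
    on. *)
Lemma vanishing_dist_limn_esup :
  (forall eta, 0 < eta -> exists t, forall i j, N (x t i - x t j) <= eta) ->
  limn_esup (fun t => (\big[Num.max/0]_(i : V) \big[Num.max/0]_(j : V)
     N (x t i - x t j))%:E) = 0%E.
Proof.
move=> small.
pose D t : R :=
  \big[Num.max/0]_(i : V) \big[Num.max/0]_(j : V) N (x t i - x t j).
have D0 : D @ \oo --> 0.
  apply/cvgrPdist_le => e e0; have [t xt] := small e e0; near=> s.
  rewrite sub0r normrN ger0_norm; last exact: bigmax_ge_id.
  apply: bigmax_le => [|i _]; [exact: ltW|apply: bigmax_le => [|j _]].
    exact: ltW.
  apply: (opinions_dist_le hN mu01 _ xt i j).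
  by near: s; exact: nbhs_infty_ge.
suff /cvg_limn_einf_sup[_ ->] : ((D t)%:E @[t --> \oo] --> 0%:E)%classic by [].
by apply: cvg_EFin => //; exact: nearW.
Unshelve. all: by end_near. Qed.

(** The second alternative records a long pair beside the bound on the sum: such a pair is what
    contradicts [diam N Delta <= eps] in the almost sure case. *)
Lemma consensus_dichotomy c r :
  (forall n, \forall t \near \oo, forall i j, [set i; j]%SET \in E t ->
     N (x t i - x t j) <= n.+1%:R^-1 \/ eps < N (x t i - x t j)) ->
  (forall i, N (x0 i - c) <= r) ->
  infinite_set [set t | connected_graph (E t)] ->
  (forall eta, 0 < eta -> exists t, forall i j, N (x t i - x t j) <= eta) \/
  ((exists t i j, eps < N (x t i - x t j)) /\
   #|V|%:R * (eps - r) <= \sum_k N (x0 k - c)).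
Proof.
move=> short xr infc.
have [|] := pselect (forall eta, 0 < eta ->
  exists t, forall i j, N (x t i - x t j) <= eta); [by left|move=> nall; right].
(* Without agents the first alternative would hold vacuously. *)
have V0 : (0 < #|V|)%N.
  rewrite lt0n; apply/eqP => V0; apply: nall => eta _; exists 0%N => i.
  by case: (fintype0 i).
have [eta /not_implyP[eta0 nsmall]] := (existsNP _).2 nall.
have long n : (#|V|%:R * n.+1%:R^-1 <= eta) ->
  (exists t i j, eps < N (x t i - x t j)) /\
  #|V|%:R * (eps - r - #|V|%:R * n.+1%:R^-1) <= \sum_k N (x0 k - c).
  move=> neta; have [T _ ET] := short n.
  have [t ct Tt] := infinite_set_ge T infc.
  have {}ET := ET t Tt.
  have n0 : (0 : R) <= n.+1%:R^-1 by rewrite invr_ge0.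
  have [[a [b [abE ab]]]|nolong] := pselect (exists a b,
    [set a; b]%SET \in E t /\ eps < N (x t a - x t b)); last first.
    exfalso; apply: nsmall; exists t => i j; apply: le_trans neta.
    apply: connected_dist_le i j => // a b abE.
    by have [//|ab] := ET a b abE; case: nolong; exists a, b.
  split; first by exists t, a, b.
  have cf := is_norm_dist_convex c hN.
  apply: le_trans (opinions_sum_le eps E sel x0 hN mu01 cf (leq0n t)).
  rewrite mulr_natl -sumr_const; apply: ler_sum => k _.
  apply: (connected_dist_center_ge hN n0 ct _ ET abE ab) => i.
  exact: (opinions_le hN mu01 cf (leq0n t)).
have v0 : 0 < #|V|%:R :> R by rewrite ltr0n.
have v1 : 1 <= #|V|%:R :> R by rewrite ler1n.
(* One [n] serves two purposes: [#|V| / n.+1 <= eta] excludes a graph with short edges only, and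
   [#|V| ^ 2 / n.+1 <= e] makes the loss in the lower bound negligible. *)
have close (e : R) : 0 < e -> exists n, #|V|%:R * n.+1%:R^-1 <= eta /\
    #|V|%:R * (#|V|%:R * n.+1%:R^-1) <= e.
  move=> e0; have m0 : 0 < Num.min eta e by rewrite lt_min eta0 e0.
  have [n] := invr_small (divr_gt0 m0 (mulr_gt0 v0 v0)).
  rewrite ler_pdivlMr ?mulr_gt0// le_min mulrC => /andP[neta ne].
  exists n; split; last by rewrite mulrA.
  apply: le_trans neta; rewrite ler_wpM2r ?invr_ge0//.
  by rewrite ler_peMl// ltW.
split; first by have [n [/long[]]] := close 1 ltr01.
(* The initial sum does not depend on [n], so the loss [e] can be sent to 0. *)
apply/ler_addgt0Pr => e /close[n [/long[_ +]]].
by rewrite mulrBr lerBlDr => nS ne; rewrite (le_trans nS)// lerD2l.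
Qed.

End LongTime.

(** * Measurability of random vectors, tracked through their real coordinates *)

Definition coord_measurable (R : realType) (d : nat) (disp : measure_display)
    (T : measurableType disp) (f : T -> 'rV[R]_d) :=
  forall k, measurable_fun setT (fun w => f w 0 k).

Section CoordMeasurable.
Variables (R : realType) (d : nat) (disp : measure_display).
Variable T : measurableType disp.
Implicit Types f g : T -> 'rV[R]_d.

Lemma coord_measurable_comb f g a : coord_measurable f -> coord_measurable g ->
  coord_measurable (fun w => f w + a *: (g w - f w)).
Proof.
move=> mf mg k; under eq_fun do rewrite !mxE.
by apply: measurable_funD => //; apply: measurable_funM => //;
  exact: measurable_funB.
Qed.

Lemma coord_measurable_sub f g : coord_measurable f -> coord_measurable g ->
  coord_measurable (fun w => f w - g w).
Proof.
move=> mf mg k; under eq_fun do rewrite !mxE.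
exact: measurable_funB.
Qed.

Lemma coord_measurable_sqnorm f : coord_measurable f ->
  measurable_fun setT (fun w => sqnorm (f w)).
Proof. by move=> mf; apply: measurable_sum => k; exact: measurable_funX. Qed.

Definition rat_point (q : 'rV[rat]_d) : 'rV[R]_d := map_mx ratr q.

Lemma rat_point_dense (N : 'rV[R]_d -> R) (x : 'rV[R]_d) a :
  is_norm N -> N x < a ->
  exists q, \sum_k `|x 0 k - rat_point q 0 k| * N (delta_mx 0 k)
    < a - N (rat_point q).
Proof.
move=> hN xa; pose C := 1 + \sum_k N (delta_mx 0 k : 'rV[R]_d).
have C0 : 0 < C by rewrite ltr_pwDl// sumr_ge0// => k _; exact: is_norm_ge0.
(* The weighted error [S] counts twice, once itself and once through [N (rat_point q) <= N x + S],
   hence the factor 2. The 1 in [C] makes [S] strictly less than [(a - N x) / 2]. *)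
have e0 : 0 < (a - N x) / (2 * C) by rewrite divr_gt0 ?mulr_gt0// subr_gt0.
set e := _ / _ in e0.
have near_rat (y : R) : exists q : rat, `|y - ratr q| < e.
  have ye : y - e < y + e by rewrite ltrBlDr -addrA ltrDl addr_gt0.
  have [q] := rat_in_itvoo ye.
  by rewrite in_itv/= => yq; exists q; rewrite ltr_distlC.
have [q qP] := choice (fun k => near_rat (x 0 k)).
exists (\row_k q k); set r := rat_point _.
have xr k : `|x 0 k - r 0 k| < e by rewrite !mxE; exact: qP.
set S := \sum_k _.
have Se : S <= e * (C - 1).
  rewrite /C [1 + _]addrC addrK mulr_sumr ler_sum// => k _.
  by rewrite ler_wpM2r ?(is_norm_ge0 hN)// ltW.
have Ce : e * C = (a - N x) / 2.
  by rewrite /e invfM mulrA mulfVK// gt_eqF.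
have NS : N (r - x) <= S.
  rewrite (is_norm_distC hN) (le_trans (is_norm_le_coord hN _))//.
  by apply: ler_sum => k _; rewrite !mxE.
have := is_norm_triangle hN x r 0; rewrite !subr0.
by move: Se; rewrite mulrBr mulr1 Ce; lra.
Qed.

(* [N] is Lipschitz for a weighted l^1 norm, so that [N z < a] is a countable
   union, over rational points [q], of conditions on the coordinates of
   [z - q]. *)
Lemma coord_measurable_norm (N : 'rV[R]_d -> R) f : is_norm N ->
  coord_measurable f -> measurable_fun setT (fun w => N (f w)).
Proof.
move=> hN mf; apply: (measurability _ (RGenInftyO.measurableE R)) => //.
move=> _ [_ [a ->] <-]; rewrite setTI.
pose S q w := \sum_k `|f w 0 k - rat_point q 0 k| * N (delta_mx 0 k).
have -> : (fun w => N (f w)) @^-1` `]-oo, a[ =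
    \bigcup_q (S q @^-1` `]-oo, a - N (rat_point q)[).
  apply/seteqP; split => [w|w [q _]] /=; rewrite !in_itv/=.
    by move=> /(rat_point_dense hN)[q qa]; exists q => //=; rewrite in_itv.
  move=> Sa; have := is_norm_triangle hN (rat_point q) (f w) 0; rewrite !subr0.
  have : N (f w - rat_point q) <= S q w.
    apply: le_trans (is_norm_le_coord hN _) _.
    by apply: ler_sum => k _; rewrite !mxE.
  by move: Sa; lra.
apply: countable_bigcupT_measurable => // q.
rewrite -[X in measurable X]setTI; apply: (_ : measurable_fun setT (S q)) => //.
apply: measurable_sum => k; apply: measurable_funM => //.
apply: measurableT_comp => //; exact: measurable_funB.
Qed.

(** Used with the selected edge as [s]: the next opinions depend on a random edge, but there are
    finitely many edges to distinguish. *)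
Lemma measurable_fun_finite_cases (S : finType) (s : T -> S)
    (g : S -> T -> R) :
  (forall e, measurable (s @^-1` [set e])) ->
  (forall e, measurable_fun setT (g e)) ->
  measurable_fun setT (fun w => g (s w) w).
Proof.
move=> ms mg _ B mB; rewrite setTI.
have -> : (fun w => g (s w) w) @^-1` B =
    \bigcup_(e in [set: S]) (s @^-1` [set e] `&` g e @^-1` B).
  by apply/seteqP; split => [w Bw|w [e _ [/= <-]]//]; exists (s w).
apply: fin_bigcup_measurable => // e _; apply: measurableI => //.
by rewrite -[X in measurable X]setTI; exact: mg.
Qed.

Lemma coord_measurable_interact (V : finType) (N : 'rV[R]_d -> R) eps m e
    (x : T -> V -> 'rV[R]_d) : is_norm N ->
  (forall i, coord_measurable (fun w => x w i)) ->
  forall i, coord_measurable (fun w => interact N eps m e (x w) i).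
Proof.
move=> hN mx i k; rewrite /interact; case: pickP => [j _|_]; last exact: mx.
have -> : (fun w => (if N (x w i - x w j) <= eps
    then x w i + m *: (x w j - x w i) else x w i) 0 k) =
  (fun w => if N (x w i - x w j) <= eps
    then (x w i + m *: (x w j - x w i)) 0 k else x w i 0 k).
  by apply/funext => w; case: ifP.
apply: measurable_fun_ifT; last exact: mx.
- apply: measurable_fun_ler => //; apply: coord_measurable_norm => //.
  exact: coord_measurable_sub.
- exact: coord_measurable_comb.
Qed.

Lemma coord_measurable_opinions (V : finType) (N : 'rV[R]_d -> R) eps mu E
    (sel : nat -> T -> {set V}) (x0 : V -> T -> 'rV[R]_d) t : is_norm N ->
  (forall i, coord_measurable (x0 i)) ->
  (forall s e, (s < t)%N -> E s != finset.set0 ->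
     measurable (sel s @^-1` [set e])) ->
  forall i, coord_measurable
    (fun w => opinions N eps mu E (sel ^~ w) (x0 ^~ w) t i).
Proof.
move=> hN mx; elim: t => [//|t IH] ms i k /=.
have {}IH := IH (fun s e st => ms s e (ltnW st)).
have [Et|Et] := eqVneq (E t) finset.set0; first exact: IH.
apply: (measurable_fun_finite_cases (s := sel t) (g := fun e w =>
  interact N eps (mu t) e (opinions N eps mu E (sel ^~ w) (x0 ^~ w) t) i 0 k)).
  by move=> e; exact: ms.
by move=> e; exact: coord_measurable_interact.
Qed.

End CoordMeasurable.

Lemma borel_rV_coord_measurable (R : realType) (d : nat) :
  coord_measurable (fun z : borel_rV R d => z : 'rV[R]_d).
Proof.
move=> k; apply: (measurability _ (RGenOpens.measurableE R)) => //.
move=> _ [_ [a [b ->]] <-]; rewrite setTI; apply: sub_sigma_algebra.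
move: (@coord_continuous R 1 d 0 k) => /continuousP; apply; exact: interval_open.
Qed.

(** * Independence of an event from a generated sigma-algebra *)

Section Independence.
Variables (R : realType) (disp : measure_display) (Omega : measurableType disp).
Variable P : probability Omega R.

Lemma independent_event_dynkin (A : set Omega) : measurable A ->
  dynkin [set B | measurable B /\ P (B `&` A) = (P B * P A)%E].
Proof.
move=> mA; split => /=.
- by split => //; rewrite setTI probability_setT mul1e.
- move=> B [mB PB]; split; first exact: measurableC.
  have -> : P (~` B `&` A) = (P A - P (B `&` A))%E.
    rewrite setIC [B `&` A]setIC -setDE; apply: measureD => //.
    by rewrite -ge0_fin_numE// fin_num_measure.
  by rewrite PB probability_setC// muleBl ?fin_num_measure// mul1e.
- move=> B tB BP; have mB n : measurable (B n) by have [] := BP n.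
  split; first exact: bigcupT_measurable.
  rewrite setI_bigcupl measure_bigcup//=; last first.
  + exact: trivIset_setIr.
  + by move=> n _; exact: measurableI.
  rewrite measure_bigcup//= muleC -(fineK (fin_num_measure P _ mA)).
  rewrite -nneseriesZl//; apply: eq_eseriesr => n _.
  by have [_ ->] := BP n; rewrite fineK ?fin_num_measure// muleC.
Qed.

Definition rectangles (I : choiceType) (F : I -> set (set Omega))
    (J : {fset I}) : set (set Omega) :=
  [set B | exists2 A, (forall k, k \in J -> F k (A k)) &
                      B = \bigcap_(k in [set` J]) A k].

Lemma rectangle_measurable (I : choiceType) (F : I -> set (set Omega))
    (J : {fset I}) : (forall k, k \in J -> F k `<=` measurable) ->
  rectangles F J `<=` measurable.
Proof.
move=> mF _ [A FA ->]; apply: fin_bigcap_measurable => [|k kJ].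
  exact: finite_fset.
by apply: (mF k) => //; exact: FA.
Qed.

(** Dynkin's pi-lambda argument. Rectangles are stable under intersection, and on a rectangle the
    product formula results from comparing independence over [J] with independence over [J] enlarged
    by [l]. *)
Lemma independent_of_rectangles (I : choiceType) (D : set I)
    (F : I -> set (set Omega)) (J : {fset I}) (l : I) (A : set Omega) :
  mutually_independent P D F -> [set` J] `<=` D -> D l -> l \notin J ->
  (forall k, k \in J -> F k `<=` measurable) ->
  (forall k, setI_closed (F k)) -> F l A -> measurable A ->
  forall B, <<s rectangles F J >> B -> P (B `&` A) = (P B * P A)%E.
Proof.
move=> indep JD Dl lJ mF FI FA mA B GB.
have /(_ B GB)[] // : <<s rectangles F J >> `<=`
    [set C | measurable C /\ P (C `&` A) = (P C * P A)%E].
apply: lambda_system_subset => //.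
- move=> C1 C2 [A1 FA1 ->] [A2 FA2 ->]; exists (fun k => A1 k `&` A2 k).
    by move=> k kJ; apply: FI; [exact: FA1|exact: FA2].
  by rewrite bigcapI.
- exact/dynkin_lambda_system/independent_event_dynkin.
- move=> C GC; split; first exact: rectangle_measurable GC.
  have [C_ FC ->] := GC.
  have PJ := indep J C_ JD FC; rewrite PJ.
  pose C' k := if k == l then A else C_ k.
  have C'C k : k \in J -> C' k = C_ k.
    by rewrite /C'; case: eqVneq => [->|//]; rewrite (negbTE lJ).
  have C'l : C' l = A by rewrite /C' eqxx.
  have lJD : [set` (l |` J)%fset] `<=` D.
    by move=> k /=; rewrite !inE => /orP[/eqP ->//|]; exact: JD.
  have FC' k : k \in (l |` J)%fset -> F k (C' k).
    rewrite !inE => /orP[/eqP ->|kJ]; first by rewrite C'l.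
    by rewrite C'C//; exact: FC.
  have := indep _ C' lJD FC'; rewrite big_fsetU1//= C'l.
  rewrite (eq_big_seq (fun k => P (C_ k))); last by move=> k kJ; rewrite C'C.
  rewrite [RHS]muleC => <-.
  congr (P _); apply/seteqP; split => [w [Cw Aw] k /=|w Cw].
    rewrite !inE => /orP[/eqP ->|kJ]; first by rewrite C'l.
    by rewrite C'C//; exact: Cw.
  split; last by have := Cw l; rewrite C'l /= !inE eqxx; exact.
  by move=> k /= kJ; rewrite -C'C//; apply: Cw; rewrite /= !inE kJ orbT.
Qed.

End Independence.

(** * The past, and its independence of the next selection *)

Section Selection.
Variables (R : realType) (d : nat) (V : finType) (N : 'rV[R]_d -> R) (eps : R).
Variables (mu : nat -> R) (E : nat -> {set {set V}}).
Variables (disp : measure_display) (Omega : measurableType disp).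
Variables (P : probability Omega R).
Variables (x0 : V -> {RV P >-> borel_rV R d}) (sel : nat -> Omega -> {set V}).
Hypotheses (hN : is_norm N) (unif : uniform_selection E P sel).
Hypothesis indep : independent_sources E x0 sel.
Local Notation x := (opinion N eps mu E x0 sel).

Definition source (k : V + nat) : set (set Omega) :=
  match k with
  | inl i => g_sigma_algebra_preimage (x0 i)
  | inr t => preimage_set_system setT (sel t) setT
  end.

(** These sources determine the opinions up to time [t], and the selection at time [t] is not among
    them. Times without edges are left out, since selections are controlled only at the others. *)
Definition past (t : nat) : {fset V + nat} :=
  [fset k in [seq inl i | i <- enum V] ++
             [seq inr s | s <- iota 0 t & E s != finset.set0]]%fset.

Lemma in_past_inl t i : inl i \in past t.
Proof. by rewrite in_fset mem_cat map_f// mem_enum. Qed.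

Lemma in_past_inr t s :
  (inr s \in past t) = (s < t)%N && (E s != finset.set0).
Proof.
rewrite in_fset mem_cat orbC mem_map; last by move=> ? ? [].
rewrite mem_filter mem_iota add0n andbC orb_idr//.
by move=> /mapP[].
Qed.

Lemma source_setI k : setI_closed (source k).
Proof.
by case: k => [i|t] _ _ [A mA <-] [B mB <-];
  (exists (A `&` B); [|rewrite !setTI]) => //; exact: measurableI.
Qed.

Lemma sel_measurable t Y : E t != finset.set0 -> measurable (sel t @^-1` Y).
Proof.
move=> /unif[msel _].
have -> : sel t @^-1` Y = \bigcup_(e in Y) sel t @^-1` [set e].
  by apply/seteqP; split => [w Yw|w [e Ye /= ->//]]; exists (sel t w).
by apply: fin_bigcup_measurable => //; exact: finite_finset.
Qed.

Lemma source_measurable t k : k \in past t -> source k `<=` measurable.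
Proof.
case: k => [i _ _ [B mB <-]|s]; first exact: measurable_funP.
rewrite in_past_inr => /andP[_ Es] _ [B _ <-].
by rewrite setTI; exact: sel_measurable.
Qed.

(** This is [Omega] with the sigma-algebra of the past, so that adaptedness is ordinary
    measurability on this type. *)
Definition pastType t := g_sigma_algebraType (rectangles source (past t)).

Lemma past_measurable t (B : set (pastType t)) :
  measurable B -> measurable (B : set Omega).
Proof.
apply: smallest_sub; first exact: sigma_algebra_measurable.
exact/rectangle_measurable/source_measurable.
Qed.

Lemma past_rectangle t k B : k \in past t -> source k B ->
  measurable (B : set (pastType t)).
Proof.
move=> kt FB; apply: sub_sigma_algebra.
exists (fun l => if l == k then B else setT).
  move=> l _; case: eqP => [->//|_]; case: l => [i|s] /=.
    by exists setT => //; rewrite setTI preimage_setT.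
  by exists setT => //; rewrite setTI preimage_setT.
apply/seteqP; split => [w Bw l _|w /(_ k kt)]; last by rewrite eqxx.
by case: eqP.
Qed.

Lemma opinion_past_measurable t s i : (s <= t)%N ->
  coord_measurable (fun w : pastType t => x s w i).
Proof.
move=> st; apply: coord_measurable_opinions => // [j k|u e us Eu].
  have mx0 : measurable_fun setT (x0 j : pastType t -> borel_rV R d).
    move=> _ B mB; apply: (@past_rectangle t (inl j) _ (in_past_inl _ _)).
    by exists B.
  exact: measurableT_comp (@borel_rV_coord_measurable R d k) mx0.
apply: (@past_rectangle t (inr u)); first by rewrite in_past_inr (leq_trans us).
by exists [set e] => //; rewrite setTI.
Qed.

Lemma opinion_measurable t i : coord_measurable (fun w => x t w i).
Proof.
move=> k _ B mB; apply: past_measurable.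
exact: (opinion_past_measurable i (leqnn t) k measurableT mB).
Qed.

Lemma selection_independent t e (B : set (pastType t)) :
  e \in E t -> measurable B ->
  P (B `&` sel t @^-1` [set e]) = (P B * (#|E t|%:R^-1)%:E)%E.
Proof.
move=> et mB; have Et : E t != finset.set0 by apply/set0Pn; exists e.
have [msel Psel] := unif Et; rewrite -(Psel e et).
apply: (independent_of_rectangles (l := inr t) indep) mB => //.
- move=> [i _//|s] /=; rewrite in_past_inr => /andP[]//.
- by rewrite in_past_inr ltnn.
- exact: source_measurable.
- exact: source_setI.
- by exists [set e] => //; rewrite setTI.
Qed.

End Selection.

(** * Almost sure long-time behaviour *)

Lemma measurable_bigmax (R : realType) (disp : measure_display)
    (T : measurableType disp) (I : Type) (s : seq I) (h : I -> T -> R) :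
  (forall i, measurable_fun setT (h i)) ->
  measurable_fun setT (fun w => \big[Num.max/0]_(i <- s) h i w).
Proof.
move=> mh; elim: s => [|i s IH].
  by under eq_fun do rewrite big_nil; exact: measurable_cst.
by under eq_fun do rewrite big_cons; exact: measurable_maxr.
Qed.

Section AlmostSure.
Variables (R : realType) (d : nat) (V : finType) (N : 'rV[R]_d -> R) (eps : R).
Variables (mu : nat -> R) (E : nat -> {set {set V}}).
Variables (disp : measure_display) (Omega : measurableType disp).
Variables (P : probability Omega R).
Variables (x0 : V -> {RV P >-> borel_rV R d}) (sel : nat -> Omega -> {set V}).
Hypotheses (hN : is_norm N) (unif : uniform_selection E P sel).
Hypothesis indep : independent_sources E x0 sel.
Hypothesis mu01 : forall t, 0 <= mu t <= 2^-1.
Variable m : R.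
Hypotheses (m0 : 0 < m) (mmu : forall t, m <= mu t).
Local Notation x := (opinion N eps mu E x0 sel).

Lemma consensus_measurable : measurable (consensus N eps mu E x0 sel).
Proof.
rewrite -[X in measurable X]setTI.
pose D t w := (\big[Num.max/0]_(i : V) \big[Num.max/0]_(j : V)
  N (x t w i - x t w j))%:E.
suff mD t : measurable_fun setT (D t).
  exact: (measurable_fun_limn_esup mD measurableT (emeasurable_set1 0%E)).
apply/measurable_EFinP; apply: measurable_bigmax => i.
apply: measurable_bigmax => j; apply: coord_measurable_norm => //.
by apply: coord_measurable_sub; exact: opinion_measurable.
Qed.

(* The truncation at energy [M] avoids the comparison of [N] from below with the
   Euclidean norm, which would be needed to bound the energy on [Delta]. *)
Definition open_edge t (i j : V) delta M : set Omega :=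
  [set w | (delta < N (x t w i - x t w j)) && (N (x t w i - x t w j) <= eps)
           && (\sum_k sqnorm (x0 k w) <= M)].

Lemma open_edge_past_measurable t i j delta M :
  measurable (open_edge t i j delta M : set (pastType E x0 sel t)).
Proof.
pose n := (fun w : pastType E x0 sel t => N (x t w i - x t w j)).
have mn : measurable_fun setT n.
  apply: coord_measurable_norm => //.
  by apply: coord_measurable_sub; exact: opinion_past_measurable.
pose b := (fun w : pastType E x0 sel t =>
  (delta < n w) && (n w <= eps) && (\sum_k sqnorm (x0 k w) <= M)).
have mb : measurable_fun setT b.
  apply: measurable_and; first apply: measurable_and.
  - exact: measurable_fun_ltr.
  - exact: measurable_fun_ler.
  - apply: measurable_fun_ler => //; apply: measurable_sum => k.
    apply: coord_measurable_sqnorm.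
    exact: (@opinion_past_measurable R d V N eps mu E disp Omega P x0 sel hN
      t 0).
have -> : open_edge t i j delta M = setT `&` b @^-1` [set true] by rewrite setTI.
exact: mb.
Qed.

Lemma open_edge_measurable t i j delta M : measurable (open_edge t i j delta M).
Proof.
exact (past_measurable unif (@open_edge_past_measurable t i j delta M)).
Qed.

(** By independence, an open edge is selected with conditional probability [1 / #|E t|], so its
    probability is at most a constant times that of a hit. The hit probabilities sum to the expected
    number of hits, which the energy budget [M] bounds. *)
Lemma open_edge_sum_bounded i j delta M : i != j -> 0 < delta ->
  exists2 C : R, 0 <= C & forall T, (\sum_(0 <= t < T)
    P (if [set i; j]%SET \in E t then open_edge t i j delta M else set0)
    <= C%:E)%E.
Proof.
move=> ij delta0; have [K K0 NK] := is_norm_sqr_le hN.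
pose eta := m * delta ^+ 2 / K.
have eta0 : 0 < eta by rewrite divr_gt0// mulr_gt0// exprn_gt0.
pose e := [set i; j]%SET.
pose hit t := if e \in E t then open_edge t i j delta M `&` sel t @^-1` [set e]
              else set0.
have mhit t : measurable (hit t).
  rewrite /hit; case: ifPn => // et; apply: measurableI.
    exact: open_edge_measurable.
  by apply: (sel_measurable unif); apply/set0Pn; exists e.
(* Paths of initial energy above [M] have no hits; the maximum with 0 makes one bound valid for all
   paths. *)
pose M' := Num.max M 0.
have M'0 : 0 <= M' by rewrite le_max lexx orbT.
(* This bounds [#|E t|] uniformly in [t]. *)
pose n := #|{set V}|.
exists (n%:R * (M' / eta)); first by rewrite mulr_ge0// divr_ge0// ltW.
move=> T.
have Phit t : (P (if e \in E t then open_edge t i j delta M else set0)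
    <= n%:R%:E * P (hit t))%E.
  rewrite /hit; case: ifPn => et; last by rewrite measure0 mule0.
  have Et0 : (0 < #|E t|)%N by apply/card_gt0P; exists e.
  rewrite (selection_independent unif indep et); last first.
    exact: open_edge_past_measurable.
  rewrite muleCA -EFinM -[leLHS]mule1 lee_wpmul2l// lee_fin.
  by rewrite ler_pdivlMr ?ltr0n// mul1r ler_nat max_card.
apply: (@le_trans _ _ (n%:R%:E * \sum_(0 <= t < T) P (hit t))%E).
  by rewrite ge0_sume_distrr//; apply: lee_sum.
rewrite EFinM lee_wpmul2l//.
have -> : (\sum_(0 <= t < T) P (hit t) =
    \int[P]_w \sum_(0 <= t < T) (\1_(hit t) w)%:E)%E.
  rewrite ge0_integral_sum//; last first.
    by move=> t; apply/measurable_EFinP; exact: measurable_indic.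
  by apply: eq_bigr => t _; rewrite integral_indic// setIT.
apply: (@le_trans _ _ (\int[P]_w (cst (M' / eta)%:E w))%E); last first.
  rewrite integral_cst// -[leRHS]mule1 lee_wpmul2l//.
    by rewrite lee_fin divr_ge0// ltW.
  exact: probability_le1.
apply: ge0_le_integral => //.
- by move=> w _; apply: sume_ge0 => t _; rewrite lee_fin.
- apply: emeasurable_sum => t; apply/measurable_EFinP; exact: measurable_indic.
move=> w _; rewrite sumEFin lee_fin ler_pdivlMr// big_mkord.
have [wM|wM] := leP (\sum_k sqnorm (x0 k w)) M.
  have := @sum_hits_le R d V N eps mu E (sel ^~ w) (x0 ^~ w) hN mu01 K m delta
    i j T K0 NK (ltW m0) mmu (ltW delta0) ij.
  move=> H; apply: le_trans (le_trans H _); last by rewrite le_max wM.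
  rewrite ler_wpM2r ?(ltW eta0)//; apply: ler_sum => t _; rewrite indicE.
  rewrite ler_nat; case: (boolP (w \in hit t)) => //; rewrite inE /hit.
  case: ifP => // et [/= /andP[-> _] ->].
  by rewrite eqxx.
rewrite big1 ?mul0r// => t _; rewrite indicE memNset// /hit; case: ifP => _ [].
by move=> /= /andP[_]; rewrite leNgt wM.
Qed.

(** Borel-Cantelli is applied for each pair, each threshold [n.+1%:R^-1] and each integer truncation
    level. These are countably many, and on a given path a level above its initial energy removes
    the truncation. *)
Lemma ae_open_edges_short : {ae P, forall w, forall n,
  \forall t \near \oo, forall i j, [set i; j]%SET \in E t ->
     N (x t w i - x t w j) <= n.+1%:R^-1 \/ eps < N (x t w i - x t w j)}.
Proof.
have ae_ij i j n M : {ae P, forall w, \forall t \near \oo,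
    i != j -> [set i; j]%SET \in E t -> \sum_k sqnorm (x0 k w) <= M%:R ->
    N (x t w i - x t w j) <= n.+1%:R^-1 \/ eps < N (x t w i - x t w j)}.
  have [ij|ij] := boolP (i != j); last by apply: aeW => w; exact: nearW.
  have n0 : (0 : R) < n.+1%:R^-1 by rewrite invr_gt0.
  have [C C0 leC] := @open_edge_sum_bounded i j _ M%:R ij n0.
  pose F t := if [set i; j]%SET \in E t then open_edge t i j n.+1%:R^-1 M%:R
              else set0.
  have mF t : measurable (F t).
    by rewrite /F; case: ifP => // _; exact: open_edge_measurable.
  have PF : P (lim_sup_set F) = 0%E.
    apply: lim_sup_set_cvg0 => //; apply: (@le_lt_trans _ _ C%:E).
      apply: lime_le; first by apply: is_cvg_nneseries.
      by apply: nearW => T; exact: leC.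
    by rewrite ltry.
  exists (lim_sup_set F); split => //.
    apply: bigcap_measurable => // k _; exact: bigcup_measurable.
  move=> w /=; apply: contra_notP => nF.
  have [T FT] : exists T, forall t, (T <= t)%N -> ~ F t w.
    apply: contra_notP nF => /forallNP nT k _.
    by have /existsNP[t /not_implyP[kt /contrapT Ft]] := nT k; exists t.
  exists T => // t /= Tt _ et wM; have := FT t Tt; rewrite /F et /open_edge /=.
  rewrite wM andbT => /negP; rewrite negb_and -leNgt -ltNge => /orP[?|?];
    by [left|right].
have : {ae P, forall w, forall n M i j, \forall t \near \oo,
    i != j -> [set i; j]%SET \in E t -> \sum_k sqnorm (x0 k w) <= M%:R ->
    N (x t w i - x t w j) <= n.+1%:R^-1 \/ eps < N (x t w i - x t w j)}.
  apply: ae_foralln => n; apply: ae_foralln => M.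
  by apply: filter_forall => i; apply: filter_forall => j; exact: ae_ij.
apply: filterS => w H n.
have wM := ltW (archi_boundP (sumr_ge0 _ (fun k _ => sqnorm_ge0 (x0 k w)))).
apply: filter_forall => i; apply: filter_forall => j.
apply: filterS (H n (Num.bound (\sum_k sqnorm (x0 k w))) i j) => t Ht et.
have [ij|/negPn/eqP ij] := boolP (i != j); first exact: Ht.
by left; rewrite ij subrr (is_norm0 hN) invr_ge0.
Qed.

Lemma ae_consensus_dichotomy c r : (forall i w, N (x0 i w - c) <= r) ->
  infinite_set [set t | connected_graph (E t)] ->
  {ae P, forall w, consensus N eps mu E x0 sel w \/
    ((exists t i j, eps < N (x t w i - x t w j)) /\
     #|V|%:R * (eps - r) <= \sum_k N (x0 k w - c))}.
Proof.
move=> xr infc; apply: filterS ae_open_edges_short => w short.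
have [small|far] := consensus_dichotomy hN mu01 short (xr ^~ w) infc.
  by left; exact: vanishing_dist_limn_esup.
by right.
Qed.

End AlmostSure.

(** * Tail of the sum of initial distances to the center *)

Section SameLaw.
Variables (R : realType) (d : nat) (disp : measure_display).
Variables (Omega : measurableType disp) (P : probability Omega R).
Implicit Types X Y : {RV P >-> borel_rV R d}.
Variables (N : 'rV[R]_d -> R) (c : 'rV[R]_d).
Hypothesis hN : is_norm N.

Lemma measurable_dist_borel :
  measurable_fun setT (fun z : borel_rV R d => N (z - c)).
Proof.
apply: coord_measurable_norm => //; apply: coord_measurable_sub.
  exact: borel_rV_coord_measurable.
by move=> k; exact: measurable_cst.
Qed.

Lemma measurable_dist_RV X : measurable_fun setT (fun w => N (X w - c)).
Proof. exact: measurableT_comp measurable_dist_borel (measurable_funP X). Qed.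

Lemma integral_dist_same_law X Y :
  (forall A, measurable A -> distribution P Y A = distribution P X A) ->
  (\int[P]_w (N (Y w - c))%:E = \int[P]_w (N (X w - c))%:E)%E.
Proof.
move=> XY; pose f (z : borel_rV R d) := (N (z - c))%:E.
have mf : measurable_fun setT f.
  by apply/measurable_EFinP; exact: measurable_dist_borel.
have f0 z : (0 <= f z)%E by rewrite lee_fin; exact: is_norm_ge0.
rewrite -[LHS](ge0_integral_distribution Y mf f0).
rewrite -[RHS](ge0_integral_distribution X mf f0); apply: eq_measure_integral.
by move=> A mA _; exact: XY.
Qed.

Lemma measurable_sum_dist_tail (V : finType)
    (x0 : V -> {RV P >-> borel_rV R d}) (a : R) :
  measurable [set w | a <= \sum_k N (x0 k w - c)].
Proof.
have mS : measurable_fun setT (fun w => a <= \sum_k N (x0 k w - c)).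
  apply: measurable_fun_ler => //.
  by apply: measurable_sum => k; exact: measurable_dist_RV.
by have := mS measurableT [set true]; rewrite setTI; exact.
Qed.

(** This is Markov's inequality for the sum: its [#|V|] expectations are equal and cancel the factor
    [#|V|] of the threshold. *)
Lemma sum_dist_tail (V : finType) (x0 : V -> {RV P >-> borel_rV R d}) X
    (a : R) :
  (forall i A, measurable A -> distribution P (x0 i) A = distribution P X A) ->
  0 < a -> (0 < #|V|)%N ->
  (P [set w | #|V|%:R * a <= \sum_k N (x0 k w - c)]%R
     <= 'E_P[fun w => N (X w - c)%R] / a%:E)%E.
Proof.
move=> law a0 V0; pose b := (#|V|%:R * a)^-1.
have va0 : 0 < #|V|%:R * a by rewrite mulr_gt0// ltr0n.
have b0 : 0 <= b by rewrite invr_ge0 ltW.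
have mB := measurable_sum_dist_tail x0 (#|V|%:R * a).
set B := [set w | _] in mB *.
rewrite -[B]setIT -(integral_indic P)//.
apply: (@le_trans _ _ (\int[P]_w (b%:E * \sum_k (N (x0 k w - c))%:E))%E).
  apply: ge0_le_integral => //.
  - by apply/measurable_EFinP; exact: measurable_indic.
  - apply: measurable_funeM; apply: emeasurable_sum => k.
    by apply/measurable_EFinP; exact: measurable_dist_RV.
  move=> w _; rewrite sumEFin -EFinM lee_fin indicE.
  have [wB|_] := boolP (w \in B); last first.
    by rewrite mulr_ge0// sumr_ge0// => k _; exact: is_norm_ge0.
  by move: wB; rewrite inE /B /= => wB; rewrite mulrC ler_pdivlMr// mul1r.
rewrite ge0_integralZl//; last 2 first.
- apply: emeasurable_sum => k; apply/measurable_EFinP.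
  exact: measurable_dist_RV.
- by move=> w _; apply: sume_ge0 => k _; rewrite lee_fin; exact: is_norm_ge0.
rewrite ge0_integral_sum//; last 2 first.
- by move=> k; apply/measurable_EFinP; exact: measurable_dist_RV.
- by move=> k w _; rewrite lee_fin; exact: is_norm_ge0.
under eq_bigr do rewrite (integral_dist_same_law (law _)).
rewrite (_ : \sum_(k : V) _ = (\int[P]_w (N (X w - c))%:E) *+ #|V|)%E; last first.
  by rewrite big_const -Monoid.iteropE.
rewrite -mule_natl muleA -EFinM muleC inver gt_eqF// [in leRHS]unlock.
suff -> : b * #|V|%:R = a^-1 by [].
by rewrite /b invfM mulrAC mulVf ?mul1r// pnatr_eq0 -lt0n.
Qed.

End SameLaw.

(** * The probability of consensus *)

Theorem theorem5 (R : realType) (d : nat) (V : finType)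
    (N : 'rV[R]_d -> R) (eps : R) (Delta : set 'rV[R]_d) (c : 'rV[R]_d)
    (mu : nat -> R) (E : nat -> {set {set V}})
    (disp : measure_display) (Omega : measurableType disp)
    (P : probability Omega R)
    (x0 : V -> {RV P >-> borel_rV R d}) (sel : nat -> Omega -> {set V})
    (X : {RV P >-> borel_rV R d}) :
  is_norm N ->
  0 < eps ->
  has_ubound (N @` Delta) ->
  convex_set (Delta : set (convex_lmodType 'rV[R]_d)) ->
  unique (is_center N Delta) c ->
  (forall t, 0 <= mu t <= 2^-1) ->
  (forall t, simple_graph (E t)) ->
  infinite_set [set t | connected_graph (E t)] ->
  (forall i w, Delta (x0 i w)) ->
  (forall i A, measurable A -> distribution P (x0 i) A = distribution P X A) ->
  uniform_selection E P sel ->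
  independent_sources E x0 sel ->
  0 < inf (range mu) ->
  radius_at N Delta c < eps ->
  (1 - 'E_P[fun w => N (X w - c)%R] / (eps - radius_at N Delta c)%R%:E
     <= P (consensus N eps mu E x0 sel))%E
  /\ (diam N Delta <= eps -> P (consensus N eps mu E x0 sel) = 1%E).
Proof.
move=> hN eps0 [B0 DeltaB] _ _ mu01 _ infc xD law unif indep m0 reps.
set r := radius_at N Delta c in reps *.
have mmu t : inf (range mu) <= mu t.
  by apply: ge_inf; [exists 0 => _ [s _ <-]; have /andP[] := mu01 s|exists t].
(* A [sup] dominates its set only when the set is bounded; [B0 + N c] is a bound here. *)
have xr i w : N (x0 i w - c) <= r.
  apply: ub_le_sup; last by exists (x0 i w).
  exists (B0 + N c) => _ [z zD <-].
  have := is_norm_triangle hN 0 z c; rewrite subr0 sub0r is_normN//.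
  by move=> /le_trans; apply; rewrite lerD2r; apply: DeltaB; exists z.
have ae := ae_consensus_dichotomy eps hN unif indep mu01 m0 mmu xr infc.
set C := consensus _ _ _ _ _ _ in ae *.
have mC : measurable C := consensus_measurable eps mu x0 hN unif.
have PC : (P C = 1 - P (~` C))%E.
  by rewrite -[in LHS](setCK C) probability_setC//; exact: measurableC.
have PC1 : {ae P, forall w, C w} -> P C = 1%E.
  move=> aeC; suff : P (~` C) = 0%E by move=> C0; rewrite PC C0 sube0.
  by apply/negligibleP; [exact: measurableC|exact: aeC].
have a0 : 0 < eps - r by rewrite subr_gt0.
split; last first.
  (* Initial distances are at most the diameter of [Delta] and stay so, which rules out a pair at
     distance above [eps]. *)
  move=> diam_eps; apply: PC1; apply: filterS ae => w [//|[[t [i [j far]]] _]].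
  exfalso; move: far; rewrite ltNge => /negP; apply; apply: le_trans diam_eps.
  apply: (opinions_dist_le hN mu01 (leq0n t)) i j => i j.
  apply: ub_le_sup; last by exists (x0 i w, x0 j w) => //; split; exact: xD.
  exists (B0 + B0) => _ [[y z] [/= yD zD] <-].
  have := is_norm_triangle hN 0 y z; rewrite subr0 sub0r is_normN//.
  by move=> /le_trans; apply; apply: lerD; apply: DeltaB; [exists y|exists z].
have EX0 : (0 <= 'E_P[fun w => N (X w - c)%R] / (eps - r)%:E)%E.
  apply: mule_ge0.
    by rewrite unlock; apply: integral_ge0 => w _; rewrite lee_fin is_norm_ge0.
  by rewrite inver gt_eqF// lee_fin invr_ge0 ltW.
(* Markov's threshold is positive only if there are agents. Without agents the far alternative is
   impossible and consensus is almost sure. *)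
have [V0|V0] := posnP #|V|.
  rewrite PC1; first by rewrite -[leRHS]sube0; exact: leeB.
  by apply: filterS ae => w [//|[[t [i _]] _]]; case: (fintype0 i).
rewrite PC; apply: leeB => //; apply: le_trans (sum_dist_tail c hN law a0 V0).
have mB := measurable_sum_dist_tail c hN x0 (#|V|%:R * (eps - r)).
set B := [set w | _] in mB *.
have mCB : measurable (~` C `\` B).
  by apply: measurableD => //; exact: measurableC.
(* Up to a null set, failure of consensus forces the Markov event [B]. *)
have CB : P (~` C `\` B) = 0%E.
  apply/negligibleP => //; apply: negligibleS ae => w [nC nB].
  by move=> [//|[_]].
have -> : P (~` C) = (P (~` C `\` B) + P (~` C `&` B))%E.
  by apply: measureDI => //; exact: measurableC.
rewrite CB add0e; apply: le_measure; rewrite ?inE//.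
by apply: measurableI => //; exact: measurableC.
Qed.
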